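(* Let $f \in \tilde{\mathscr{A}}$. If there exists some $n \in \mathbb{Z}$ with $|n| > 1$ such that the entrywise product $\mathrm{TS}_n f$ is a residual square root of $n$, then the image of $f$ in $\mathscr{A}$ is naively transcendental.
   Context: $\mathbb{P}$ denotes the set of prime numbers; $\mathbb{F}_p = \mathbb{Z}/p\mathbb{Z}$; $\mathbb{Z}_{(p)} \subset \mathbb{Q}$ is the localisation of $\mathbb{Z}$ at the prime ideal $p\mathbb{Z}$. For $q_0, q_1 \in \mathbb{Q}$ and $p \in \mathbb{P}$, $q_0 \equiv q_1 \pmod{p}$ means $q_0 - q_1 \in p\mathbb{Z}_{(p)}$ and $q_1 \in \mathbb{Z}_{(p)}$. For $q \in \mathbb{Z}_{(p)}$, $q \bmod p \in \mathbb{F}_p$ is its residue class, and for $q \in \mathbb{Q} \setminus \mathbb{Z}_{(p)}$ one sets $q \bmod p = 0$. $\mathscr{A} = \prod_{p \in \mathbb{P}} \mathbb{F}_p \big/ \bigoplus_{p \in \mathbb{P}} \mathbb{F}_p$, a commutative $\mathbb{Q}$-algebra. $\tilde{\mathscr{A}}$ is the set of $a \in \mathbb{Q}^{\mathbb{P}}$ such that $a(p) \notin \mathbb{Z}_{(p)}$ for only finitely many $p \in \mathbb{P}$. The image of $a \in \tilde{\mathscr{A}}$ in $\mathscr{A}$ is the class of $(a(p) \bmod p)_{p \in \mathbb{P}}$. An element $\alpha \in \mathscr{A}$ is naively algebraic if there is a nonzero $g \in \mathbb{Q}[x]$ with $g(\alpha) = 0$, and naively transcendental otherwise. For a positive integer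 $m$, $u_2(m)$ denotes the greatest odd divisor of $m$. For $n \in \mathbb{Z}$, Tonelli--Shanks power of $n$ is the map $\mathrm{TS}_n \colon \mathbb{P} \to \mathbb{Z}$, $\mathrm{TS}_n(p) = n^{\frac{u_2(p-1)+1}{2}}$. For $n \in \mathbb{Z}$, an element $r \in \tilde{\mathscr{A}}$ is a residual square root of $n$ if there exists some $q \in \mathbb{Q}^{\times}$ such that for every $p \in \mathbb{P}$: if $\left(\frac{n}{p}\right) = -1$ then $r(p) \equiv q \pmod{p}$, and if $\left(\frac{n}{p}\right) \neq -1$ then $r(p)^2 \equiv n \pmod{p}$. Here $\left(\frac{n}{p}\right)$ is the Legendre symbol, with $\left(\frac{n}{p}\right) = -1$ meaning that $n$ is not congruent to a square modulo $p$ (so this never occurs for $p = 2$). *)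

(* Defs.v *)
From HB Require Import structures.
From mathcomp Require Import all_boot all_order all_algebra.
From mathcomp Require Import ring_quotient ring.
From mathcomp Require Import boolp classical_sets functions cardinality.

Set Implicit Arguments.
Unset Strict Implicit.
Unset Printing Implicit Defensive.

Import Order.TTheory GRing.Theory Num.Theory.
Local Open Scope ring_scope.
Local Open Scope quotient_scope.

Definition primeT : Type := {p : nat | prime p}.

Definition nat_of_primeT (p : primeT) : nat := sval p.
Coercion nat_of_primeT : primeT >-> nat.

Lemma primeTP (p : primeT) : prime p. Proof. by case: p. Qed.

(* Z_(p): [denq q] is the denominator of [q] in lowest terms; [ZlocP] recovers
   the usual description as a localisation. *)
Definition Zloc (p : primeT) : {pred rat} :=
  fun q => ~~ ((p : nat)%:Z %| denq q)%Z.

Definition eqQmod (p : primeT) (q0 q1 : rat) : Prop :=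
  (exists2 z, z \in Zloc p & q0 - q1 = (p : nat)%:R * z) /\ q1 \in Zloc p.

Definition modQ (p : primeT) (q : rat) : 'F_p :=
  if q \in Zloc p then (numq q)%:~R / (denq q)%:~R else 0.

Lemma intrFp_eq0 (p : primeT) (z : int) :
  ((z%:~R : 'F_p) == 0) = ((p : nat)%:Z %| z)%Z.
Proof.
have pp := primeTP p; rewrite dvdzE /=.
have natE n : ((n%:R : 'F_p) == 0) = (p %| n)%N.
  by rewrite -val_eqE /= val_Fp_nat.
by case: z => n; rewrite /= ?NegzE ?mulrNz ?oppr_eq0 -?pmulrn natE.
Qed.

Lemma dvdz_denq (q : rat) (a b : int) : b%:~R * q = a%:~R -> (denq q %| b)%Z.
Proof.
rewrite -[q]divq_num_den mulrA => /(canRL (mulfVK _)).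
rewrite divq_num_den intr_eq0 denq_neq0 => /(_ isT).
rewrite -!rmorphM /= => /intr_inj E.
have : (denq q %| b * numq q)%Z by rewrite E dvdz_mull.
by rewrite Gauss_dvdzl // coprimezE coprime_sym coprime_num_den.
Qed.

Lemma ZlocPn (p : primeT) (q : rat) (a b : int) :
  ~~ ((p : nat)%:Z %| b)%Z -> b%:~R * q = a%:~R -> q \in Zloc p.
Proof.
move=> pb /dvdz_denq db; apply: contra pb => pd; exact: dvdz_trans db.
Qed.

Lemma ZlocP (p : primeT) (q : rat) :
  reflect (exists a b : int, ~~ ((p : nat)%:Z %| b)%Z /\ q = a%:~R / b%:~R)
          (q \in Zloc p).
Proof.
apply: (iffP idP) => [qp|[a [b [pb ->]]]].
  by exists (numq q), (denq q); rewrite divq_num_den.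
apply: (ZlocPn pb (a := a)); rewrite mulrC divfK // intr_eq0.
by apply: contraNneq pb => ->; rewrite dvdz0.
Qed.

Lemma modQE (p : primeT) (q : rat) (a b : int) :
  ~~ ((p : nat)%:Z %| b)%Z -> b%:~R * q = a%:~R ->
  b%:~R * modQ p q = a%:~R.
Proof.
move=> pb E; rewrite /modQ (ZlocPn pb E).
have d0 : ((denq q)%:~R : 'F_p) != 0 by rewrite intrFp_eq0; apply: ZlocPn pb E.
apply: (mulIf d0); rewrite mulrA divfK // -!rmorphM /=; congr (_%:~R).
apply: (@intr_inj rat); rewrite !rmorphM /= -E -mulrA; congr (_ * _).
by rewrite -{2}[q]divq_num_den divfK // intr_eq0 denq_neq0.
Qed.

Lemma modQ_int (p : primeT) (z : int) : modQ p z%:~R = z%:~R.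
Proof.
rewrite -[LHS]mul1r; apply: (@modQE p _ z 1); last by rewrite mul1r.
by rewrite dvdz1 /= neq_ltn prime_gt1 ?primeTP ?orbT.
Qed.

Lemma numq_denM (q : rat) : (denq q)%:~R * q = (numq q)%:~R.
Proof. by rewrite mulrC -{1}[q]divq_num_den divfK // intr_eq0 denq_neq0. Qed.

Section ModQMorph.
Variables (p : primeT) (q r : rat).
Hypotheses (qp : q \in Zloc p) (rp : r \in Zloc p).

Let b := denq q * denq r.

Let pb : ~~ ((p : nat)%:Z %| b)%Z.
Proof. by rewrite -intrFp_eq0 rmorphM mulf_neq0 //= intrFp_eq0. Qed.

Let b0 : (b%:~R : 'F_p) != 0. Proof. by rewrite intrFp_eq0. Qed.

Lemma modQD : modQ p (q + r) = modQ p q + modQ p r.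
Proof.
apply: (mulfI b0).
rewrite (modQE (a := numq q * denq r + denq q * numq r) pb); last first.
  by rewrite rmorphD !rmorphM /= -!numq_denM; ring.
rewrite mulrDr rmorphM -mulrA (mulrC (denq r)%:~R) mulrA (modQE qp (numq_denM q)).
rewrite -mulrA (modQE rp (numq_denM r)).
by rewrite rmorphD !rmorphM.
Qed.

Lemma modQM : modQ p (q * r) = modQ p q * modQ p r.
Proof.
apply: (mulfI b0).
rewrite (modQE (a := numq q * numq r) pb); last first.
  by rewrite !rmorphM /= -!numq_denM; ring.
rewrite /b !rmorphM /= mulrACA (modQE qp (numq_denM q)).
by rewrite (modQE rp (numq_denM r)).
Qed.

End ModQMorph.

Definition prodFp : Type := forall p : primeT, 'F_p.

HB.instance Definition _ := gen_eqMixin prodFp.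
HB.instance Definition _ := gen_choiceMixin prodFp.

Section ProdFpRing.
Implicit Types a b c : prodFp.

Let zero : prodFp := fun=> 0.
Let one : prodFp := fun=> 1.
Let opp a : prodFp := fun p => - a p.
Let add a b : prodFp := fun p => a p + b p.
Let mul a b : prodFp := fun p => a p * b p.

Let addA : associative add.
Proof. by move=> a b c; apply: functional_extensionality_dep => p; exact: addrA. Qed.
Let addC : commutative add.
Proof. by move=> a b; apply: functional_extensionality_dep => p; exact: addrC. Qed.
Let add0 : left_id zero add.
Proof. by move=> a; apply: functional_extensionality_dep => p; exact: add0r. Qed.
Let addN : left_inverse zero opp add.
Proof. by move=> a; apply: functional_extensionality_dep => p; exact: addNr. Qed.

HB.instance Definition _ := GRing.isZmodule.Build prodFp addA addC add0 addN.

Let mulA : associative mul.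
Proof. by move=> a b c; apply: functional_extensionality_dep => p; exact: mulrA. Qed.
Let mulC : commutative mul.
Proof. by move=> a b; apply: functional_extensionality_dep => p; exact: mulrC. Qed.
Let mul1 : left_id one mul.
Proof. by move=> a; apply: functional_extensionality_dep => p; exact: mul1r. Qed.
Let mulD : left_distributive mul +%R.
Proof. by move=> a b c; apply: functional_extensionality_dep => p; exact: mulrDl. Qed.
Let one_neq0 : one != 0.
Proof.
apply/eqP => /(congr1 (fun a : prodFp => a (exist _ 2 isT))) /eqP.
by rewrite (oner_eq0 'F_2).
Qed.

HB.instance Definition _ :=
  GRing.Zmodule_isComNzRing.Build prodFp mulA mulC mul1 mulD one_neq0.

End ProdFpRing.

Definition sumFp : {pred prodFp} :=
  fun a => `[< finite_set [set p | a p <> 0]%classic >].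

Lemma finite_primeT (m : nat) : finite_set [set p : primeT | (p <= m)%N]%classic.
Proof.
apply: (@sub_finite_set _ _ (nat_of_primeT @^-1` `I_m.+1)%classic) => //.
apply: finite_preimage; last exact: finite_II.
by move=> p q _ _; exact: val_inj.
Qed.

Lemma infinite_primeT : ~ finite_set [set: primeT]%classic.
Proof.
move=> /(finite_image nat_of_primeT) /finite_seqP [s sE].
have [p pm pp] := prime_above (\max_(i <- s) i).
have : [set` s]%classic p by rewrite -sE; exists (exist _ p pp).
by move=> /= ps; move: pm; rewrite ltnNge (leq_bigmax_seq (F := id)).
Qed.

Lemma sumFp_ideal : idealr_closed sumFp.
Proof.
split.
- apply/asboolP; apply: sub_finite_set (finite_set0 _) => p /=; exact.
- apply/negP => /asboolP H; apply: infinite_primeT.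
  by apply: sub_finite_set H => p _ /=; apply/eqP; exact: oner_neq0.
- move=> a x y /asboolP hx /asboolP hy; apply/asboolP.
  apply: (@sub_finite_set _ _ ([set p | x p <> 0] `|` [set p | y p <> 0])%classic).
    move=> p /= h; have [x0|/eqP] := eqVneq (x p) 0; last by left.
    right => y0; apply: h; change (a p * x p + y p = 0).
    by rewrite x0 y0 mulr0 addr0.
  by rewrite finite_setU.
Qed.

HB.instance Definition _ := isIdealr.Build prodFp sumFp sumFp_ideal.

Definition scrA : Type := {ideal_quot sumFp}.
HB.instance Definition _ := GRing.ComNzRing.on scrA.

Definition Atilde : set (primeT -> rat) :=
  [set a | finite_set [set p | a p \notin Zloc p]]%classic.

Definition imA (a : primeT -> rat) : scrA :=
  \pi_({ideal_quot sumFp}) ((fun p => modQ p (a p)) : prodFp).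

Lemma imA_eq (a : primeT -> rat) (x : prodFp) (m : nat) :
  (forall p : primeT, (m < p)%N -> modQ p (a p) = x p) ->
  imA a = \pi_({ideal_quot sumFp}) x.
Proof.
move=> h; apply/eqP; rewrite -Quotient.idealrBE; apply/asboolP.
apply: sub_finite_set (finite_primeT m) => p /= hp.
rewrite leqNgt; apply/negP => /h E; apply: hp.
by change (modQ p (a p) - x p = 0); rewrite E subrr.
Qed.

Lemma Zloc_large (q : rat) (p : primeT) : (`|denq q| < p)%N -> q \in Zloc p.
Proof.
move=> qp; apply/negP; rewrite dvdzE /= => /dvdn_leq.
by rewrite absz_gt0 denq_neq0 leqNgt qp => /(_ isT).
Qed.

(* Structure map of scrA as a Q-algebra; it is a ring morphism only because
   finitely many coordinates are ignored. *)
Definition ratA (q : rat) : scrA := imA (fun=> q).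

Lemma ratAD : {morph ratA : q r / q + r}.
Proof.
move=> q r; rewrite /ratA {2 3}/imA -rmorphD.
apply: (imA_eq (m := maxn `|denq q| `|denq r|)) => p.
by rewrite gtn_max => /andP[qp rp]; apply: modQD; apply: Zloc_large.
Qed.

Lemma ratAM : {morph ratA : q r / q * r}.
Proof.
move=> q r; rewrite /ratA {2 3}/imA -rmorphM.
apply: (imA_eq (m := maxn `|denq q| `|denq r|)) => p.
by rewrite gtn_max => /andP[qp rp]; apply: modQM; apply: Zloc_large.
Qed.

Lemma ratA1 : ratA 1 = 1.
Proof.
rewrite /ratA -[RHS](rmorph1 (\pi_({ideal_quot sumFp}))).
by apply: (imA_eq (m := 0)) => p _; exact: (modQ_int p 1).
Qed.

Section ScrAAlgebra.

Let scale (q : rat) (x : scrA) : scrA := ratA q * x.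

Let scaleA q r x : scale q (scale r x) = scale (q * r) x.
Proof. by rewrite /scale ratAM mulrA. Qed.
Let scale1 : left_id 1 scale.
Proof. by move=> x; rewrite /scale ratA1 mul1r. Qed.
Let scaleDr : right_distributive scale +%R.
Proof. by move=> q x y; rewrite /scale mulrDr. Qed.
Let scaleDl x : {morph scale^~ x : q r / q + r}.
Proof. by move=> q r; rewrite /scale ratAD mulrDl. Qed.

HB.instance Definition _ :=
  GRing.Zmodule_isLmodule.Build rat scrA scaleA scale1 scaleDr scaleDl.

Let scaleAl (q : rat) (x y : scrA) : q *: (x * y) = q *: x * y.
Proof. by rewrite /GRing.scale /= /scale mulrA. Qed.

HB.instance Definition _ := GRing.Lmodule_isLalgebra.Build rat scrA scaleAl.
HB.instance Definition _ := GRing.Lalgebra_isComAlgebra.Build rat scrA.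

End ScrAAlgebra.

Definition naively_algebraic (x : scrA) : Prop :=
  exists2 g : {poly rat}, g != 0 & horner_alg x g = 0.

Definition naively_transcendental (x : scrA) : Prop := ~ naively_algebraic x.

Definition u2 (m : nat) : nat := \max_(d <- divisors m | odd d) d.

Definition TS (n : int) (p : primeT) : int := n ^+ ((u2 p.-1).+1 %/ 2).

(* At p = 2 every residue is a square, so the value -1 does not occur. *)
Definition legendre (n : int) (p : primeT) : int :=
  if (n%:~R : 'F_p) == 0 then 0
  else if [exists x : 'F_p, x ^+ 2 == n%:~R] then 1 else -1.

Definition residual_sqrt (n : int) (r : primeT -> rat) : Prop :=
  Atilde r /\
  exists2 q : rat, q != 0 &
    forall p : primeT,
      (legendre n p = -1 -> eqQmod p (r p) q) /\
      (legendre n p <> -1 -> eqQmod p (r p ^+ 2) n%:~R).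

(* Main.v *)
(** Write [u] for the odd part of [p - 1], [F] for the residue of [f p] modulo
    [p], and [q = a / b].  The hypothesis gives [A * F^2 * n^u = B] in [F_p],
    where [(A, B)] is [(1, 1)] if [n] is a square modulo [p], and
    [(b^2 * n, a^2)] otherwise.  For every [k > 0] there are arbitrarily large
    primes [p] dividing some [n^(2^k * l) + 1] with [l] odd; for these
    [(n^u)^(2^k) = -1], so [F] is a root of [(A * X^2)^(2^k) + B^(2^k)].
    A nonzero integer polynomial [G] is coprime over the rationals to this
    polynomial once [k] is large, because a complex number satisfies
    [z^(2^k) = -1] for at most one [k].  By Bezout the two polynomials then have
    no common root modulo a large prime, so [F] is not a root of [G]. *)

Require Import Defs.
From mathcomp Require Import all_boot all_order all_algebra.
From mathcomp Require Import algC finfield.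
From mathcomp Require Import ring_quotient ring zify.
From mathcomp Require Import boolp classical_sets functions cardinality.
Set Implicit Arguments.
Unset Strict Implicit.
Unset Printing Implicit Defensive.

Import Order.TTheory GRing.Theory Num.Theory.
Local Open Scope ring_scope.

(** * Primes [p] at which the odd-part power of [n] has prescribed 2-power order *)

Lemma expr_coprime_eq1 {R : comNzRingType} (x : R) (m n : nat) :
  coprime m n -> x ^+ m = 1 -> x ^+ n = 1 -> x = 1.
Proof.
case: m => [|m] cmn xm xn.
  by move: cmn; rewrite /coprime gcd0n => /eqP n1; rewrite -xn n1 expr1.
case: (egcdnP n (ltn0Sn m)) => u v e _.
have : x ^+ (u * m.+1) = 1 by rewrite mulnC exprM xm expr1n.
by rewrite e (eqP cmn) exprD mulnC exprM xn expr1n mul1r expr1.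
Qed.

Lemma bigmax_in_filter (s : seq nat) (P : pred nat) :
  has P s -> \max_(d <- s | P d) d \in filter P s.
Proof.
elim: s => //= d s IH; rewrite big_cons.
case Pd: (P d) => //= _; have [/IH ms|nos] := boolP (has P s).
  by rewrite /maxn; case: ifP => _; rewrite inE ?ms ?eqxx ?orbT.
by rewrite big_hasC // maxn0 inE eqxx.
Qed.

Lemma u2_odd_dvd (m : nat) : (0 < m)%N -> odd (u2 m) && (u2 m %| m)%N.
Proof.
move=> m0; rewrite (dvdn_divisors _ m0) -mem_filter bigmax_in_filter //.
by apply/hasP; exists 1%N; rewrite // -dvdn_divisors ?dvd1n.
Qed.

(** [u2 m] is the [2^']-part of [m]: being odd, it divides that part, which is itself an odd divisor
    of [m] and so at most the maximum. *)
Lemma dvdn_u2 (m : nat) : (0 < m)%N -> (m %| 2 ^ logn 2 m * u2 m)%N.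
Proof.
move=> m0; rewrite -{1}(partnC 2%N m0) p_part dvdn_mul //.
have o : odd (m`_2^')%N by rewrite odd_2'nat part_pnat.
have /andP[ou du] := u2_odd_dvd m0.
suff -> : u2 m = (m`_2^')%N by [].
apply/eqP; rewrite eqn_leq; apply/andP; split.
  rewrite dvdn_leq ?part_gt0 //.
  rewrite -(@Gauss_dvdr _ (m`_2)%N) ?partnC // p_part coprimeXr //.
  by rewrite coprimen2.
by rewrite (leq_bigmax_seq (F := id)) // -dvdn_divisors // dvdn_part.
Qed.

Lemma expFp_pred (p : primeT) (x : 'F_p) : x != 0 -> x ^+ p.-1 = 1.
Proof.
move=> x0; apply: (mulfI x0); rewrite mulr1 -exprS prednK ?prime_gt0 ?primeTP //.
by have := expf_card x; rewrite card_Fp ?primeTP.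
Qed.

(* A prime factor of the [l]-th cyclotomic polynomial at [- a], with [l] a
   prime exceeding [B] and [a + 1], is congruent to 1 modulo [l]. *)
Lemma prime_dvd_expz_add1 (a : int) (B : nat) : 1 < a ->
  exists (p : primeT) (l : nat),
    [/\ (B < p)%N, odd l & (a%:~R : 'F_p) ^+ l = -1].
Proof.
move=> a1; have [l lB pl] := prime_above (maxn B `|a + 1|).
move: lB; rewrite gtn_max => /andP[lB la].
have lodd : odd l by case: (even_prime pl) => // l2; lia.
have l1 := prime_gt1 pl.
pose S : int := \sum_(i < l) (- a) ^+ i.
have ES : (- a - 1) * S = (- a) ^+ l - 1 by rewrite subrX1.
(* Here [(a + 1) * S = a ^ l + 1 > a + 1], so [S] has a prime factor. *)
have absS : (1 < `|S|)%N.
  have al : a < a ^+ l by rewrite -{1}[a]expr1 ltr_eXn2l.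
  move: ES; rewrite exprNn -signr_odd lodd expr1 mulN1r => ES.
  rewrite ltnNge; apply/negP => S1.
  have : S = 0 \/ S = 1 \/ S = -1 by lia.
  by case=> [|[]] E; move: ES; rewrite E; lia.
have pp := pdiv_prime absS.
pose p : primeT := exist _ (pdiv `|S|) pp.
pose x : 'F_p := (- a)%:~R.
have pS : (S%:~R : 'F_p) = 0.
  by apply/eqP; rewrite intrFp_eq0 dvdzE /= pdiv_dvd.
have xl : x ^+ l = 1.
  have : (((- a) ^+ l - 1)%:~R : 'F_p) = 0 by rewrite -ES rmorphM /= pS mulr0.
  by rewrite rmorphB rmorphXn /= => /eqP; rewrite subr_eq0 => /eqP.
have x0 : x != 0.
  by apply/eqP => x0; move: xl; rewrite x0 expr0n; case: (l) l1 => // _ _ /eqP;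
     rewrite eq_sym oner_eq0.
(* If [x = 1], each of the [l] terms of [S] is 1 modulo [p], so [p = l]; but then [l] divides
   [a + 1], which is positive and smaller than [l]. *)
have x1 : x != 1.
  apply/eqP => x1.
  have : ((l%:Z)%:~R : 'F_p) = 0.
    rewrite -pmulrn -pS /S rmorph_sum /=.
    under eq_bigr do rewrite rmorphXn /= -/x x1 expr1n.
    by rewrite sumr_const card_ord.
  move/eqP; rewrite intrFp_eq0 dvdzE /= => dl.
  have el : pdiv `|S| = l.
    by apply/eqP; move: dl; rewrite dvdn_prime2.
  have : ((- a - 1)%:~R : 'F_p) == 0 by rewrite rmorphB /= -/x x1 subrr.
  rewrite intrFp_eq0 dvdzE /= el.
  by move/dvdn_leq; lia.
exists p, l; split => //; last first.
  move: xl; rewrite /x rmorphN exprNn -signr_odd lodd expr1 mulN1r.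
  by move/(canRL (@opprK _)).
apply: ltn_trans lB _; have p1 := prime_gt1 pp.
(* Otherwise [l] is coprime to [p - 1], and [x ^ l = x ^ (p - 1) = 1] forces [x = 1]. *)
have : (l %| p.-1)%N.
  apply: contraNT x1; rewrite -prime_coprime // => cl.
  by apply/eqP; apply: expr_coprime_eq1 cl xl _; apply: expFp_pred.
move/dvdn_leq; rewrite /p /=; lia.
Qed.

(** The preceding lemma is applied to [n ^ (2 ^ k)], which exceeds 1 even for negative [n] because
    [k > 0] makes the exponent even. *)
Lemma primes_u2_power_eqN1 (n : int) (k B : nat) : 1 < `|n| -> (0 < k)%N ->
  exists p : primeT, [/\ (B < p)%N, (n%:~R : 'F_p) != 0 &
    ((n%:~R : 'F_p) ^+ u2 p.-1) ^+ (2 ^ k) = -1].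
Proof.
move=> n1 k0.
have a1 : 1 < n ^+ (2 ^ k).
  rewrite -[k]prednK // expnS exprM -real_normK ?num_real // -exprM -expnS.
  by rewrite exprn_egt1 // -lt0n expn_gt0.
have [p [l [pB lodd e]]] := prime_dvd_expz_add1 (maxn B 2) a1.
move: pB; rewrite gtn_max => /andP[pB p2].
set x := (n%:~R : 'F_p) in e *.
have x0 : x != 0.
  apply/eqP => x0; move: e; rewrite rmorphXn /= -/x x0 !expr0n expn_eq0 /=.
  rewrite expr0n; case: (l) lodd => //= _ _ /eqP.
  by rewrite eq_sym oppr_eq0 oner_eq0.
exists p; split => //.
have m0 : (0 < p.-1)%N by lia.
have /andP[ou _] := u2_odd_dvd m0.
set u := u2 p.-1 in ou *.
pose y := - (x ^+ u ^+ (2 ^ k)).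
suff : y = 1 by move/(canRL (@opprK _)).
have Nodd m (z : 'F_p) : odd m -> (- z) ^+ m = - z ^+ m.
  by move=> om; rewrite exprNn -signr_odd om expr1 mulN1r.
(* The order of [y] divides the odd number [l] by the choice of [p], and a power of 2 by Fermat's
   little theorem. *)
apply: (@expr_coprime_eq1 _ _ l (2 ^ (logn 2 p.-1).+1)).
- by rewrite coprimeXr // coprimen2.
- rewrite Nodd // -!exprM mulnC exprM.
  rewrite rmorphXn /= -/x -exprM in e.
  by rewrite e Nodd // expr1n opprK.
- rewrite expnS exprM sqrrN -!exprM.
  have /dvdnP[c ec] := dvdn_u2 m0; rewrite -/u in ec.
  have -> : (u * 2 ^ k * (2 * 2 ^ logn 2 p.-1) =
             2 ^ logn 2 p.-1 * u * (2 ^ k * 2))%N by lia.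
  by rewrite ec mulnAC mulnC exprM expFp_pred // expr1n.
Qed.

(** * Coprimality over the rationals and reduction modulo large primes *)

(** Once an iterated square equals -1, all later ones equal 1, which differs from -1 in
    characteristic zero. *)
Lemma exp2n_eqN1_bounded {R : numDomainType} (z : R) :
  exists N, forall k, (N <= k)%N -> z ^+ (2 ^ k) != -1.
Proof.
have [[j zj]|none] := pselect (exists j, z ^+ (2 ^ j) = -1); last first.
  by exists 0%N => k _; apply/eqP => zk; apply: none; exists k.
exists j.+1 => k jk; rewrite -(subnKC jk) expnD exprM expnSr exprM.
rewrite zj sqrrN !expr1n -subr_eq0 opprK -mulr2n.
by rewrite pnatr_eq0.
Qed.

(** Integer coefficients let the same polynomial be read over [rat], [algC] and every ['F_p]. *)
Definition two_power_poly (A B : int) (k : nat) : {poly int} :=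
  (A *: 'X^2) ^+ (2 ^ k) + (B ^+ (2 ^ k))%:P.

Lemma horner_two_power_poly (R : comNzRingType) (A B : int) (k : nat) (x : R) :
  (map_poly intr (two_power_poly A B k)).[x] =
  (A%:~R * x ^+ 2) ^+ (2 ^ k) + B%:~R ^+ (2 ^ k).
Proof.
rewrite rmorphD rmorphXn /= map_polyZ map_polyXn map_polyC /=.
by rewrite hornerD horner_exp hornerZ hornerXn hornerC rmorphXn.
Qed.

(** A common root [x] in [algC] would give [(A * x ^ 2 / B) ^ (2 ^ k) = -1]; each of the finitely
    many roots of [G] allows this only for small [k]. *)
Lemma coprimep_two_power_poly (G : {poly int}) (A B : int) :
  G != 0 -> B != 0 ->
  exists N, forall k, (N <= k)%N ->
    coprimep (map_poly intr G : {poly rat}) (map_poly intr (two_power_poly A B k)).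
Proof.
move=> G0 B0.
pose Gc : {poly algC} := map_poly intr G.
have Gc0 : Gc != 0.
  by rewrite -size_poly_eq0 size_map_inj_poly ?size_poly_eq0 //; exact: intr_inj.
have [s Gs] := closed_field_poly_normal Gc.
have B0c : (B%:~R : algC) != 0 by rewrite intr_eq0.
have [N sN] : exists N, forall k, (N <= k)%N -> forall x, x \in s ->
    (A%:~R * x ^+ 2 / B%:~R) ^+ (2 ^ k) != -1.
  elim: (s) => [|x t [N tN]]; first by exists 0%N.
  have [M xM] := exp2n_eqN1_bounded (A%:~R * x ^+ 2 / B%:~R).
  exists (maxn M N) => k; rewrite geq_max => /andP[Mk Nk] y.
  by rewrite inE => /predU1P[->|]; [exact: xM|exact: tN].
exists N => k Nk; rewrite -(coprimep_map (ratr : {rmorphism rat -> algC})).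
have intrE (H : {poly int}) :
    map_poly (ratr : rat -> algC) (map_poly intr H) = map_poly intr H.
  by rewrite -map_poly_comp; apply: eq_map_poly => z /=; rewrite ratr_int.
rewrite !intrE; apply/Pdiv.ClosedField.coprimepP => x.
rewrite -/Gc Gs rootZ ?lead_coef_eq0 // root_prod_XsubC => xs.
apply: contra (sN k Nk x xs); rewrite horner_two_power_poly addr_eq0 => /eqP e.
by rewrite expr_div_n e mulNr divff // expf_neq0.
Qed.

(** Clearing denominators in a Bezout relation gives a nonzero integer [m] in the ideal generated by
    [G] and [H]; a common root modulo [p] forces [p] to divide [m]. *)
Lemma coprimep_no_common_root_Fp (G H : {poly int}) :
  coprimep (map_poly intr G : {poly rat}) (map_poly intr H) ->
  exists M, forall (p : primeT) (x : 'F_p), (M < p)%N ->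
    (map_poly intr G).[x] = 0 -> (map_poly intr H).[x] != 0.
Proof.
case/Bezout_coprimepP => -[U V] /= /eqpP[[c d] /= /andP[c0 d0] e].
(* The factor [c / d] normalises the Bezout combination to 1. *)
have [U' [a a0 EU]] := rat_poly_scale ((c / d) *: U).
have [V' [b b0 EV]] := rat_poly_scale ((c / d) *: V).
have {}e : (b *: U') * G + (a *: V') * H = (a * b)%:P.
  apply: (@map_inj_poly _ _ (intr : int -> rat) intr_inj) => //.
  have a0r : (a%:~R : rat) != 0 by rewrite intr_eq0.
  have b0r : (b%:~R : rat) != 0 by rewrite intr_eq0.
  rewrite rmorphD !rmorphM /= !map_polyZ map_polyC /=.
  rewrite -[map_poly intr U'](scalerKV a0r) -EU -[map_poly intr V'](scalerKV b0r) -EV.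
  rewrite !scalerA -!scalerAl [b%:~R * _]mulrC -scalerDr.
  have -> : U * map_poly intr G + V * map_poly intr H = (d / c) *: 1.
    by rewrite [d / c]mulrC -scalerA -e scalerK.
  rewrite scalerA alg_polyC map_polyC -polyCM; congr (_%:P).
  by field; rewrite c0 d0.
move: (a * b) (mulf_neq0 a0 b0) e => m m0 e; exists (absz m) => p x pM Gx; apply/eqP => Hx.
have : (map_poly intr ((b *: U') * G + (a *: V') * H)).[x] = 0 :> 'F_p.
  by rewrite rmorphD !rmorphM /= hornerD !hornerM Gx Hx !mulr0 addr0.
rewrite e map_polyC hornerC => /eqP; rewrite intrFp_eq0 dvdzE /=.
by move/dvdn_leq; rewrite absz_gt0 m0 leqNgt pM => /(_ isT).
Qed.

(** * From equations in [scrA] to congruences modulo all large primes *)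

Lemma finite_primeT_bounded (P : primeT -> Prop) :
  finite_set [set p | P p]%classic -> exists M, forall p : primeT, (M < p)%N -> ~ P p.
Proof.
move=> /finite_seqP[s sE]; exists (\max_(p <- s) nat_of_primeT p) => p pM Pp.
have : [set` s]%classic p by rewrite -sE.
by move=> /= ps; move: pM; rewrite ltnNge (leq_bigmax_seq (F := nat_of_primeT)).
Qed.

Lemma int_Zloc (p : primeT) (i : int) : (i%:~R : rat) \in Zloc p.
Proof.
apply: (@ZlocPn p _ i 1); rewrite ?mul1r //.
by rewrite dvdz1 /= neq_ltn prime_gt1 ?primeTP ?orbT.
Qed.

Lemma modQ_eqQmod (p : primeT) (q0 q1 : rat) :
  eqQmod p q0 q1 -> modQ p q0 = modQ p q1.
Proof.
move=> [[z zp /eqP]]; rewrite subr_eq => /eqP-> q1p.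
have pE : ((p : nat)%:R : rat) = ((p : nat)%:Z)%:~R by rewrite -pmulrn.
have pp : ((p : nat)%:R : rat) \in Zloc p by rewrite pE int_Zloc.
have pz : (p : nat)%:R * z \in Zloc p.
  have /ZlocP[a [b [pb ->]]] := zp; apply/ZlocP; exists ((p : nat)%:Z * a), b.
  by rewrite rmorphM /= pE mulrA.
rewrite (modQD pz q1p) (modQM pp zp) pE modQ_int.
have /eqP-> : (((p : nat)%:Z)%:~R : 'F_p) == 0 by rewrite intrFp_eq0 dvdzz.
by rewrite mul0r add0r.
Qed.

Lemma horner_prodFp (G : {poly int}) (a : prodFp) (p : primeT) :
  (map_poly intr G).[a] p = (map_poly intr G).[a p].
Proof.
elim/poly_ind: G => [|G c IH]; first by rewrite !rmorph0 !horner0.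
rewrite !rmorphD !rmorphM /= !map_polyX !map_polyC /= !hornerE.
have intE (z : int) : (z%:~R : prodFp) p = z%:~R.
  have natE m : (m%:R : prodFp) p = m%:R.
    by elim: m => // m IHm; rewrite !mulrS -IHm.
  case: z => m; first exact: natE.
  by rewrite !NegzE !mulrNz -!pmulrn -natE.
by rewrite -IH -intE.
Qed.

(** With denominators cleared, the polynomial can be evaluated in [prodFp], which is not a rational
    algebra; its value lies in [sumFp], so it vanishes at all large primes. *)
Lemma naively_algebraic_intpoly (f : primeT -> rat) :
  naively_algebraic (imA f) ->
  exists2 G : {poly int}, G != 0 & exists M, forall p : primeT, (M < p)%N ->
    (map_poly intr G).[modQ p (f p)] = 0.
Proof.
move=> [g g0]; have [G [a a0 gE]] := rat_poly_scale g.
have a0r : (a%:~R : rat) != 0 by rewrite intr_eq0.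
move=> eg; have e : horner_alg (imA f) (map_poly intr G) = 0.
  by rewrite -[map_poly intr G](scalerKV a0r) -gE linearZ /= eg mulr0.
exists G; first by apply: contraNneq g0 => G0; rewrite gE G0 rmorph0 scaler0.
pose F : prodFp := fun p => modQ p (f p).
have {}e : \pi_({ideal_quot sumFp})%qT ((map_poly intr G).[F]) = 0.
  rewrite -[RHS]e /horner_alg /horner_morph -map_poly_comp -horner_map /=.
  rewrite -map_poly_comp; congr (_.[_]).
  apply: eq_map_poly => z; transitivity (z%:~R : scrA).
    exact: (rmorph_int \pi_({ideal_quot sumFp})%qT z).
  exact: esym (rmorph_int (GRing.in_alg scrA) z).
have : (map_poly intr G).[F] \in sumFp.
  by rewrite -[X in X \in _]subr0 Quotient.idealrBE e rmorph0.
move=> /asboolP /finite_primeT_bounded[M hM]; exists M => p /hM.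
by rewrite horner_prodFp => /contrapT.
Qed.

Theorem corollary5p6 (f : primeT -> rat) (hf : Atilde f)
    (hTS : exists n : int, 1 < `|n| /\
             residual_sqrt n (fun p : primeT => (TS n p)%:~R * f p)) :
  naively_transcendental (imA f).
Proof.
move=> /naively_algebraic_intpoly[G G0 [M0 hG]].
have [n [n1 [_ [q q0 hq]]]] := hTS.
have [Mf hMf] := finite_primeT_bounded hf.
pose a := numq q; pose b := denq q.
have a0 : a ^+ 2 != 0 by rewrite expf_neq0 // numq_eq0.
have [N1 hN1] := coprimep_two_power_poly 1 G0 (oner_neq0 int).
have [N2 hN2] := coprimep_two_power_poly (b ^+ 2 * n) G0 a0.
(* One [k] serves both cases, since [p] is chosen after it; the successor ensures [k > 0]. *)
pose k := (maxn N1 N2).+1.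
have [M1 hM1] : exists M, forall (p : primeT) (x : 'F_p), (M < p)%N ->
    (map_poly intr G).[x] = 0 -> (map_poly intr (two_power_poly 1 1 k)).[x] != 0.
  by apply/coprimep_no_common_root_Fp/hN1; rewrite leqW // leq_maxl.
have [M2 hM2] : exists M, forall (p : primeT) (x : 'F_p), (M < p)%N ->
    (map_poly intr G).[x] = 0 ->
    (map_poly intr (two_power_poly (b ^+ 2 * n) (a ^+ 2) k)).[x] != 0.
  by apply/coprimep_no_common_root_Fp/hN2; rewrite leqW // leq_maxr.
have [p []] := primes_u2_power_eqN1 (maxn (maxn M0 Mf) (maxn M1 (maxn M2 2)))
  n1 (ltn0Sn _ : (0 < k)%N).
rewrite !gtn_max -!andbA => /and5P[pM0 pMf pM1 pM2 p2] n0 nu.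
set u := u2 p.-1 in nu.
have fp : f p \in Zloc p by apply: contrapT => /negP; exact: hMf.
set F := modQ p (f p).
(* As [u] is odd, halving [u + 1] is exact. *)
have TS2 : ((TS n p)%:~R : 'F_p) ^+ 2 = n%:~R * n%:~R ^+ u.
  have /andP[ou _] : odd u && (u %| p.-1)%N by apply: u2_odd_dvd; lia.
  rewrite /TS -/u rmorphXn /= -exprM divnK ?exprS //.
  by rewrite dvdn2 /= negbK.
have modr : modQ p ((TS n p)%:~R * f p) = (TS n p)%:~R * F.
  by rewrite modQM ?int_Zloc // modQ_int.
have rp : (TS n p)%:~R * f p \in Zloc p.
  have /ZlocP[c [d [pd ->]]] := fp; apply/ZlocP; exists (TS n p * c), d.
  by rewrite rmorphM /= mulrA.
have GF : (map_poly intr G).[F] = 0 by apply: hG.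
have power_root (A B : 'F_p) : A * F ^+ 2 * n%:~R ^+ u = B ->
    (A * F ^+ 2) ^+ (2 ^ k) + B ^+ (2 ^ k) = 0.
  by move=> <-; rewrite [(A * _ * _) ^+ _]exprMn nu mulrN1 subrr.
have [ns|/eqP ns] := eqVneq (legendre n p) (-1).
- have /modQ_eqQmod := (hq p).1 ns; rewrite modr => e.
  have qp : q \in Zloc p by case: ((hq p).1 ns).
  have {}e : b%:~R * ((TS n p)%:~R * F) = a%:~R.
    by rewrite e; apply: modQE => //; exact: numq_denM.
  move/eqP: (hM2 p F pM2 GF); apply.
  rewrite horner_two_power_poly; apply: power_root.
  (* Squaring [e] gives the relation with [A = b ^ 2 * n] and [B = a ^ 2]. *)
  by rewrite rmorphM !rmorphXn /= -e !exprMn TS2; ring.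
- have /modQ_eqQmod := (hq p).2 ns.
  rewrite expr2 modQM // modr modQ_int -expr2 exprMn TS2 => e.
  move/eqP: (hM1 p F pM1 GF); apply.
  rewrite horner_two_power_poly; apply: power_root.
  (* The relation [e] carries an extra factor [n] on both sides, invertible modulo [p]. *)
  by apply: (mulfI n0); rewrite mulr1 -[RHS]e; ring.
Qed.
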